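(* Let $d\ge 1$ be an integer, let $\sigma\ge 1$ be real, and let $\alpha\in\mathbb{R}^d$. If $\alpha\notin\Omega_d(\sigma-1)$, then $(\mathbb{T}^d,\mu,T_\alpha)$ does not have $s$MSTP for $s = \frac{d+\sigma-1}{d}$.
   Context: $\mathbb{T}^d=\mathbb{R}^d/\mathbb{Z}^d$, $\mu$ is the probability Haar measure on $\mathbb{T}^d$, and $T_\alpha:\mathbb{T}^d\to\mathbb{T}^d$ is $T_\alpha(x)=x+\alpha$. For $a\in\mathbb{R}$, $\|a\| := \inf_{p\in\mathbb{Z}}|a-p|$, and for $a\in\mathbb{R}^d$, $\|a\|_{\mathbb{Z}} := \max_i\|a_i\|$, where $a_i$ is the $i$-th component. The metric on $\mathbb{T}^d$ is $(x,y)\mapsto\|x-y\|_{\mathbb{Z}}$, and $B(x,r)$ denotes the open ball of center $x$ and radius $r$ (empty if $r=0$). For $\tau\ge 0$, $\Omega_d(\tau) := \{\alpha\in\mathbb{R}^d \mid \exists C>0 \text{ such that } \forall k\in\mathbb{N},\ \|k\alpha\|_{\mathbb{Z}}\ge C k^{-(1+\tau)/d}\}$, where $\mathbb{N}=\{1,2,\dots\}$. $\mathcal{DR}$ is the set of functions $r:\mathbb{N}\to\mathbb{R}_{\ge 0}$, $n \mapsto r_n$, with $r_n\ge r_{n+1}$ for all $n\in\mathbb{N}$. Let $(M,\mu,T)$ be a measure preserving dynamical system on a metric space $M$ with $\mu(M)<\infty$ and Borel sets measurable. A sequence of measurable sets $\{A_n\}_{n\in\mathbb{N}}$ with $\sum_{n=1}^\infty\mu(A_n)=\infty$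 is called Borel–Cantelli (BC) for $T$ if $\mu(\limsup_n T^{-n}A_n)=\mu(M)$, where $\limsup_n T^{-n}A_n = \{x\in M \mid T^n(x)\in A_n \text{ for infinitely many } n\in\mathbb{N}\}$. For $s\ge 1$, the system has the $s$-exponent monotone shrinking target property ($s$MSTP) if for any $x\in M$ and any $r\in\mathcal{DR}$ such that $A_n := B(x,r_n)$ satisfies $\sum_{n=1}^\infty(\mu(A_n))^s=\infty$, the sequence $\{A_n\}$ is BC for $T$. *)

(* Defs.v *)
From HB Require Import structures.
From mathcomp Require Import all_boot all_order all_algebra.
From mathcomp Require Import ring lra.
From mathcomp Require Import all_classical all_reals all_analysis.

Set Implicit Arguments.
Unset Strict Implicit.
Unset Printing Implicit Defensive.

Import Order.TTheory GRing.Theory Num.Theory.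
Import numFieldNormedType.Exports.

Local Open Scope classical_set_scope.
Local Open Scope ring_scope.
Local Open Scope quotient_scope.

#[short(type="metricMeasurableType")]
HB.structure Definition MetricMeasurable (R : numDomainType) disp :=
  {M of Metric R M & Measurable disp M}.

Record mpSystem (R : realType) (disp : measure_display) := MPSystem {
  mps_space :> metricMeasurableType R disp;
  mps_measure : {finite_measure set mps_space -> \bar R};
  mps_map : mps_space -> mps_space;
  mps_borel : forall U : set mps_space, open U -> measurable U;
  mps_measurable : measurable_fun setT mps_map;
  mps_preserving : forall A : set mps_space, measurable A ->
    mps_measure (mps_map @^-1` A) = mps_measure A
}.

(* Sequences indexed by the positive integers are functions on [nat] whose
   value at 0 is never used. *)
Section shrinking_targets.
Variables (R : realType) (disp : measure_display) (S : mpSystem R disp).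

Definition limsup_hits (A : nat -> set S) : set S :=
  [set x | infinite_set [set n | (0 < n)%N /\ A n (iter n (@mps_map R disp S) x)]].

Definition Borel_Cantelli (A : nat -> set S) : Prop :=
  [/\ forall n, (0 < n)%N -> measurable (A n),
      (\sum_(1 <= n <oo) mps_measure S (A n) = +oo)%E &
      mps_measure S (limsup_hits A) = mps_measure S setT].

Definition DR (r : nat -> R) : Prop :=
  forall n, (0 < n)%N -> 0 <= r n /\ r n.+1 <= r n.

(* By [ballEmdist], [ball x (r n)] is the open ball of radius [r n] for the
   distance [mdist], hence empty when [r n = 0]. *)
Definition sMSTP (s : R) : Prop :=
  forall (x : S) (r : nat -> R), DR r ->
    (\sum_(1 <= n <oo) mps_measure S (ball x (r n)) `^ s = +oo)%E ->
    Borel_Cantelli (fun n => ball x (r n)).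

End shrinking_targets.

Section distance_to_integers.
Variable R : realType.
Implicit Types a b : R.

Definition distZ a : R := inf [set `|a - p%:~R| | p in [set: int]].

Lemma distZ_le a (p : int) : distZ a <= `|a - p%:~R|.
Proof.
by apply: ge_inf; [exists 0 => _ [q _ <-]; exact: normr_ge0|exists p].
Qed.

Lemma distZ_attained a : exists p : int, distZ a = `|a - p%:~R|.
Proof.
exists (Num.floor (a + 2^-1)).
set p := Num.floor _.
have hp : `|a - p%:~R| <= 2^-1.
  have /andP[h1 h2] := floor_itv (a + 2^-1).
  rewrite -/p intrD in h1 h2.
  by rewrite ler_norml; apply/andP; split; lra.
apply/eqP; rewrite eq_le distZ_le /=.
apply: lb_le_inf; first by exists `|a - p%:~R|, p.
move=> _ [q _ <-]; have [->//|qp] := eqVneq q p.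
have : (1 : R) <= `|(p - q)%:~R|.
  by rewrite -intr_norm ler1z -gtz0_ge1 normr_gt0 subr_eq0 eq_sym.
have -> : (p - q)%:~R = (a - q%:~R) - (a - p%:~R) :> R by rewrite intrB; ring.
have := ler_normB (a - q%:~R) (a - p%:~R); lra.
Qed.

Lemma distZ_ge0 a : 0 <= distZ a.
Proof. by have [p ->] := distZ_attained a. Qed.

Lemma distZN a : distZ (- a) = distZ a.
Proof.
have le b : distZ (- b) <= distZ b.
  have [p ->] := distZ_attained b; apply: le_trans (distZ_le _ (- p)) _.
  by rewrite intrN -opprD normrN.
by apply/eqP; rewrite eq_le le -{1}[a]opprK le.
Qed.

Lemma distZD a b : distZ (a + b) <= distZ a + distZ b.
Proof.
have [p ->] := distZ_attained a; have [q ->] := distZ_attained b.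
apply: le_trans (distZ_le _ (p + q)) _; rewrite intrD opprD addrACA.
exact: ler_normD.
Qed.

Lemma distZ_eq0 a : (distZ a == 0) = (a \is a Num.int).
Proof.
apply/eqP/intrP => [|[p ->]].
  by have [p ->] := distZ_attained a => /normr0_eq0/subr0_eq ->; exists p.
apply/eqP; rewrite eq_le distZ_ge0 andbT.
by have := distZ_le p%:~R p; rewrite subrr normr0.
Qed.

End distance_to_integers.

Section supremum_norm.
Variables (R : realType) (d : nat).
Implicit Types a b : 'rV[R]_d.

(* [distZ] is nonnegative, so the default value 0 does not affect the maximum
   when 0 < d. *)
Definition normZ a : R := \big[Num.max/0]_(i < d) distZ (a 0 i).

Lemma normZ_ge0 a : 0 <= normZ a.
Proof.
rewrite /normZ; elim/big_ind : _ => [//|x y x0 _|i _]; last exact: distZ_ge0.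
by rewrite le_max x0.
Qed.

Lemma distZ_le_normZ a i : distZ (a 0 i) <= normZ a.
Proof. by rewrite /normZ (bigD1 i)//= le_max lexx. Qed.

Lemma normZ_le a (c : R) :
  0 <= c -> (forall i, distZ (a 0 i) <= c) -> normZ a <= c.
Proof.
by move=> c0 h; rewrite /normZ; elim/big_ind : _ => // x y xc yc; rewrite ge_max xc.
Qed.

Lemma normZN a : normZ (- a) = normZ a.
Proof. by apply: eq_bigr => i _; rewrite mxE distZN. Qed.

Lemma normZD a b : normZ (a + b) <= normZ a + normZ b.
Proof.
apply: normZ_le => [|i]; first by rewrite addr_ge0 ?normZ_ge0.
by rewrite mxE (le_trans (distZD _ _))// lerD ?distZ_le_normZ.
Qed.

Lemma normZ_eq0 a : (normZ a == 0) = (a \is a mxOver Num.int).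
Proof.
apply/eqP/mxOverP => [a0 i j|aZ].
  by rewrite ord1 -distZ_eq0 eq_le distZ_ge0 andbT -a0 distZ_le_normZ.
apply/eqP; rewrite eq_le normZ_ge0 andbT; apply: normZ_le => // i.
by have := aZ 0 i; rewrite -distZ_eq0 => /eqP ->.
Qed.

End supremum_norm.

Section torus.
Variables (R : realType) (d : nat).

Definition int_lattice : pred 'rV[R]_d := [pred a | a \is a mxOver Num.int].

Fact int_lattice_zmod_closed : zmod_closed int_lattice.
Proof.
split=> [|a b /mxOverP aZ /mxOverP bZ]; first by apply/mxOverP => i j; rewrite mxE.
by apply/mxOverP => i j; rewrite !mxE rpredB.
Qed.

HB.instance Definition _ :=
  GRing.isZmodClosed.Build 'rV[R]_d int_lattice int_lattice_zmod_closed.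

Definition torus : Type :=
  Quotient.quot (GRing.ZmodClosed.clone 'rV[R]_d int_lattice _).

HB.instance Definition _ := Choice.on torus.
HB.instance Definition _ := EqQuotient.on torus.
HB.instance Definition _ := GRing.Zmodule.on torus.
HB.instance Definition _ := ZmodQuotient.on torus.
HB.instance Definition _ := isPointed.Build torus 0.

Definition torus_norm (x : torus) : R := normZ (repr x).

Lemma torus_norm_pi (a : 'rV[R]_d) : torus_norm (\pi a) = normZ a.
Proof.
have le (b c : 'rV[R]_d) : b - c \in int_lattice -> normZ b <= normZ c.
  rewrite -[b in normZ b](subrK c) inE -normZ_eq0 => /eqP bc.
  by rewrite (le_trans (normZD _ _))// bc add0r.
have /eqP : \pi_torus (repr (\pi_torus a)) = \pi_torus a by rewrite reprK.
rewrite -Quotient.idealrBE => h; apply/eqP; rewrite eq_le !le//.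
by rewrite -opprB rpredN.
Qed.

Definition torus_dist (x y : torus) : R := torus_norm (x - y).

Fact torus_distxx x : torus_dist x x = 0.
Proof.
rewrite /torus_dist subrr -(pi_zeror (s := torus)) torus_norm_pi.
by apply/eqP; rewrite normZ_eq0; exact: int_lattice_zmod_closed.1.
Qed.

Fact torus_dist_eq0 x y : torus_dist x y = 0 -> x = y.
Proof.
rewrite -[x]reprK -[y]reprK /torus_dist -raddfB torus_norm_pi => /eqP.
by rewrite normZ_eq0 => xy; apply/eqP; rewrite -Quotient.idealrBE.
Qed.

Fact torus_distC x y : torus_dist x y = torus_dist y x.
Proof.
by rewrite -[x]reprK -[y]reprK /torus_dist -!raddfB !torus_norm_pi -normZN opprB.
Qed.

Fact torus_dist_triangle y x z :
  torus_dist x z <= torus_dist x y + torus_dist y z.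
Proof.
rewrite -[x]reprK -[y]reprK -[z]reprK /torus_dist -!raddfB !torus_norm_pi.
by rewrite -[X in normZ X](subrKA (repr y)) normZD.
Qed.

HB.instance Definition _ := @isMetric.Build R torus torus_dist
  torus_distxx torus_dist_eq0 torus_distC torus_dist_triangle.

HB.instance Definition _ := @isMeasurable.Build (sigma_display (@open torus))
  torus <<s @open torus >> (@sigma_algebra0 _ setT _)
  (@sigma_algebraC _ _) (@sigma_algebra_bigcup _ setT _).

End torus.

Section rotation.
Variables (R : realType) (d : nat).

(* The measurable sets of [torus R d] are the Borel sets; on them the Haar
   probability is the unique translation-invariant probability measure. *)
Definition is_Haar (mu : probability (torus R d) R) : Prop :=
  forall (b : torus R d) (A : set (torus R d)), measurable A ->
    mu ([set x + b | x in A]) = mu A.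

Variable alpha : 'rV[R]_d.

Definition rotation (x : torus R d) : torus R d := x + \pi alpha.

Fact rotation_measurable : measurable_fun setT rotation.
Proof.
apply: (@measurability _ _ _ _ setT rotation (@open (torus R d)) erefl).
move=> _ [U oU <-]; rewrite setTI; apply: sub_sigma_algebra.
apply: open_comp oU => x _ V /nbhs_ballP[e e0 eV]; apply/nbhs_ballP.
exists e => // y; rewrite ballEmdist => xy; apply: eV; rewrite ballEmdist /=.
by move: xy; rewrite /mdist /= /torus_dist /rotation opprD addrACA subrr addr0.
Qed.

Variables (mu : probability (torus R d) R) (muH : is_Haar mu).

Fact rotation_preserving (A : set (torus R d)) :
  measurable A -> mu (rotation @^-1` A) = mu A.
Proof.
move=> mA; rewrite -(muH (- \pi alpha) mA); congr (mu _).
apply/seteqP; split => [x Ax|_ [x Ax <-]]; last by rewrite /rotation /= subrK.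
by exists (rotation x) => //; rewrite /rotation addrK.
Qed.

Definition rotation_system : mpSystem R _ :=
  @MPSystem R _ (torus R d) mu rotation
    (fun U => @sub_sigma_algebra _ setT open U)
    rotation_measurable rotation_preserving.

End rotation.

Definition Omega (R : realType) (d : nat) (tau : R) : set 'rV[R]_d :=
  [set alpha | exists2 C : R, 0 < C & forall k : nat, (0 < k)%N ->
     C * k%:R `^ (- (1 + tau) / d%:R) <= normZ (k%:R *: alpha)].

Arguments Omega {R} d tau.

(* Main.v *)
(* Since alpha is too well approximable, for every Q there is k with
   |k alpha| <= C k^(-sigma/d), where C may be chosen depending on Q.  Along
   m k consecutive times the orbit then stays within m |k alpha| of only k
   points.  Keep the radius equal to rho = 1/(4N), N ~ Q k^(1/d), during such a
   block of times, with m |k alpha| <= rho: the points hitting the target during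
   the block lie in k balls of radius 2 rho, of total measure at most 1/Q,
   whereas the sum of mu(B(0, rho))^s over the block is about
   m k (4N)^(-(d + sigma - 1)), which is at least 1 for C small.  Concatenating
   blocks with Q >= 2^(j+2) makes the sum of the mu(A_n)^s diverge while the
   limsup set has measure at most 1/2. *)

Require Import Defs.
From mathcomp Require Import all_boot all_order all_algebra.
From mathcomp Require Import ring lra zify.
From mathcomp Require Import all_classical all_reals all_analysis.

Import Order.TTheory GRing.Theory Num.Theory.
Local Open Scope classical_set_scope.
Local Open Scope ring_scope.
Local Open Scope quotient_scope.

Set Implicit Arguments.
Unset Strict Implicit.
Unset Printing Implicit Defensive.

(** * Covering and packing bounds for finite families of sets *)

Lemma measure_bigcup_seq_le disp (T : measurableType disp) (R : realType)
    (m : {measure set T -> \bar R}) (I : choiceType) (s : seq I)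
    (F : I -> set T) (A : set T) (c : R) :
  (forall i, measurable (F i)) -> measurable A ->
  A `<=` \bigcup_(i in [set` s]) F i -> (forall i, (m (F i) <= c%:E)%E) ->
  (m A <= (c *+ size s)%:E)%E.
Proof.
move=> mF mA AF mc; apply: (@le_trans _ _ (\sum_(i <- s) m (F i))%E).
  have {AF mA} : (m A <= m (\big[setU/set0]_(i <- s) F i))%E.
    rewrite -bigcup_seq; apply: le_measure; rewrite ?inE//.
    by rewrite bigcup_seq; exact: bigsetU_measurable.
  move=> /le_trans; apply; elim: s => [|i s IH]; first by rewrite !big_nil measure0.
  rewrite !big_cons; apply: le_trans (measureU2 _ _ _) _ => //.
    exact: bigsetU_measurable.
  by rewrite leeD2l.
apply: (@le_trans _ _ (\sum_(i <- s) c%:E)%E); first exact: lee_sum.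
by rewrite sumEFin big_const_seq count_predT iter_addr addr0.
Qed.

Lemma measure_disjoint_seq disp (T : measurableType disp) (R : realType)
    (m : probability T R) (I : choiceType) (s : seq I)
    (F : I -> set T) (c : R) : uniq s ->
  (forall i, measurable (F i)) -> trivIset [set` s] F ->
  (forall i, m (F i) = c%:E) -> c *+ size s <= 1.
Proof.
move=> us mF tF mc; rewrite -lee_fin.
have <- : m (\bigcup_(i in [set` s]) F i) = (c *+ size s)%:E.
  rewrite measure_fin_bigcup//.
  rewrite -fsbig_seq// (eq_bigr (fun=> c%:E)) => [|i _]; last exact: mc.
  by rewrite sumEFin big_const_seq count_predT iter_addr addr0.
by apply: probability_le1; apply: fin_bigcup_measurable.
Qed.

(** * Haar measure of balls, estimated from both sides with a grid *)

Section torus_balls.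
Variables (R : realType) (d : nat).
Implicit Types (x y : torus R d) (a b : 'rV[R]_d) (e : R).

Lemma torus_ballE x e y : ball x e y = (torus_norm (x - y) < e) :> Prop.
Proof. by rewrite ballEmdist. Qed.

Lemma open_torus_ball x e : open (ball x e).
Proof.
rewrite openE => y; rewrite torus_ballE => xy; apply/nbhs_ballP.
exists (e - torus_norm (x - y)); first by rewrite /= subr_gt0.
move=> z; rewrite !torus_ballE => yz.
have := @torus_dist_triangle R d y x z; rewrite /torus_dist; lra.
Qed.

Lemma measurable_torus_ball x e : measurable (ball x e).
Proof. by apply: sub_sigma_algebra; exact: open_torus_ball. Qed.

Lemma torus_ball_translate x e :
  ball x e = [set y + x | y in ball (0 : torus R d) e].
Proof.
apply/seteqP; split => [y|_ [y + <-]].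
  rewrite torus_ballE => xy; exists (y - x); last by rewrite subrK.
  by rewrite torus_ballE sub0r opprB.
by rewrite !torus_ballE sub0r opprD addrCA subrr addr0.
Qed.

Variables (mu : probability (torus R d) R) (muH : is_Haar mu).

Lemma Haar_ball x e : mu (ball x e) = mu (ball (0 : torus R d) e).
Proof. by rewrite torus_ball_translate muH//; exact: measurable_torus_ball. Qed.

Definition grid_point (N : nat) (p : {ffun 'I_d -> 'I_N}) : torus R d :=
  \pi_(torus R d) (\row_i ((p i)%:R / N%:R)).

(** The difference minus an integer [z] is (m - n - z N) / N. Its integer numerator cannot vanish
    because 0 < |m - n| < N. *)
Lemma distZ_grid (N m n : nat) : (m < N)%N -> (n < N)%N -> m != n ->
  N%:R^-1 <= distZ (m%:R / N%:R - n%:R / N%:R : R).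
Proof.
move=> mN nN mn; have [z ->] := distZ_attained (m%:R / N%:R - n%:R / N%:R : R).
have N0 : 0 < N%:R :> R by rewrite ltr0n (leq_ltn_trans _ mN).
have -> : m%:R / N%:R - n%:R / N%:R - z%:~R = (m%:Z - n%:Z - z * N%:Z)%:~R / N%:R :> R.
  by rewrite !intrB intrM -!pmulrn; field; rewrite gt_eqF.
rewrite normrM [X in _ <= _ * X]gtr0_norm ?invr_gt0// ler_pMl ?invr_gt0//.
rewrite -intr_norm ler1z -gtz0_ge1 normr_gt0; apply/eqP => h.
have : (m%:Z - n%:Z = z * N%:Z) by lia.
have [->|z0] := eqVneq z 0; first by lia.
nia.
Qed.

(** Packing: distinct grid points are at least 1/N apart, so the N^d balls of radius 1/(2N) around
    them are disjoint, and by invariance they have equal measure. *)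
Lemma Haar_ball_le (N : nat) : (0 < N)%N ->
  (mu (ball (0%R : torus R d) (2 * N%:R)^-1) <= ((N%:R ^+ d)^-1)%:E)%E.
Proof.
move=> N0; have fm : mu (ball (0 : torus R d) (2 * N%:R)^-1) \is a fin_num.
  by apply: fin_num_measure; exact: measurable_torus_ball.
rewrite -(fineK fm) lee_fin; set c := fine _.
have := @measure_disjoint_seq _ _ _ mu _ (enum {ffun 'I_d -> 'I_N})
  (fun p => ball (grid_point p) (2 * N%:R)^-1) c (enum_uniq _).
rewrite -cardE card_ffun !card_ord => h.
have NR : 0 < N%:R ^+ d :> R by rewrite exprn_gt0// ltr0n.
rewrite -[leRHS]mul1r ler_pdivlMr// -natrX mulr_natr.
apply: h => [p||p]; first exact: measurable_torus_ball.
  move=> p q _ _ [y []]; rewrite !torus_ballE => py qy; apply/eqP/contraT => pq.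
  have /existsP[i pqi] : [exists i, p i != q i].
    rewrite -negb_forall; apply: contraNN pq => /forallP pq.
    by apply/eqP/ffunP => i; apply/eqP.
  have : N%:R^-1 <= torus_norm (grid_point p - grid_point q).
    rewrite /grid_point -raddfB torus_norm_pi; apply: le_trans (distZ_le_normZ _ i).
    by rewrite !mxE; apply: distZ_grid; rewrite ?ltn_ord.
  have := @torus_dist_triangle R d y (grid_point p) (grid_point q).
  rewrite /torus_dist; have := torus_distC (grid_point q) y; rewrite /torus_dist.
  by rewrite invfM in py qy; lra.
by rewrite Haar_ball fineK.
Qed.

(** Covering: rounding each coordinate to a multiple of 1/N costs at most 1/(2N), so the N^d balls
    of radius 1/N around the grid points cover the torus. *)
Lemma Haar_ball_ge (N : nat) : (0 < N)%N ->
  (((N%:R ^+ d)^-1)%:E <= mu (ball (0%R : torus R d) N%:R^-1))%E.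
Proof.
move=> N0; have fm : mu (ball (0 : torus R d) N%:R^-1) \is a fin_num.
  by apply: fin_num_measure; exact: measurable_torus_ball.
rewrite -(fineK fm) lee_fin; set c := fine _.
have := @measure_bigcup_seq_le _ _ _ mu _ (enum {ffun 'I_d -> 'I_N})
  (fun p => ball (grid_point p) N%:R^-1) setT c.
rewrite -cardE card_ffun !card_ord => h.
have NR : 0 < N%:R ^+ d :> R by rewrite exprn_gt0// ltr0n.
rewrite -[leLHS]mul1r ler_pdivrMr// -natrX mulr_natr -lee_fin -(probability_setT mu).
apply: h => [p||x _|p] //; first exact: measurable_torus_ball.
  have NR0 : 0 < N%:R :> R by rewrite ltr0n.
  (* [f i] is the integer nearest to N x_i. Its residue mod N selects the grid point; its quotient
     by N is the integer translation that [distZ] absorbs. *)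
  pose f (i : 'I_d) : int := Num.floor (repr x 0 i * N%:R + 2^-1).
  have fN i : (`|(f i %% N)%Z|%N < N)%N.
    rewrite -ltz_nat gez0_abs ?modz_ge0 ?ltz_pmod//; lia.
  exists [ffun i => Ordinal (fN i)]; first by rewrite /= mem_enum.
  rewrite torus_ballE -[x in _ - x]reprK /grid_point -raddfB torus_norm_pi.
  rewrite -normZN opprB; apply: (@le_lt_trans _ _ (2^-1 / N%:R)); last first.
    by rewrite gtr_pMl ?invr_gt0//; lra.
  apply: normZ_le => [|i]; first by rewrite divr_ge0.
  rewrite !mxE ffunE /=; apply: le_trans (distZ_le _ (f i %/ N)%Z) _.
  have -> : `|(f i %% N)%Z|%N%:R = (f i - (f i %/ N)%Z * N%:Z)%:~R :> R.
    rewrite pmulrn gez0_abs ?modz_ge0//; lia.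
  have -> : repr x 0 i - (f i - (f i %/ N)%Z * N%:Z)%:~R / N%:R - (f i %/ N)%Z%:~R
      = (repr x 0 i * N%:R - (f i)%:~R) / N%:R.
    by rewrite !(intrB, intrM) -!pmulrn; field; rewrite gt_eqF.
  rewrite normrM [X in _ * X]gtr0_norm ?invr_gt0// ler_pM2r ?invr_gt0//.
  have /andP[] := floor_itv (repr x 0 i * N%:R + 2^-1); rewrite -/(f i) intrD => h1 h2.
  by rewrite ler_norml; apply/andP; split; lra.
by rewrite -[leLHS]/(mu _) Haar_ball fineK.
Qed.

End torus_balls.

(** * Arithmetic of the radius and the length of one block *)

(* [delta] stands for |k alpha|. *)
Lemma block_parameters (R : realType) (d k Q : nat) (sigma delta : R) :
  (0 < d)%N -> 1 <= sigma -> (0 < k)%N -> (0 < Q)%N ->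
  delta <= (2 * (8 * Q%:R) `^ (d%:R + sigma))^-1 * k%:R `^ (- (sigma / d%:R)) ->
  exists N m : nat, [/\ (Q <= N)%N, (0 < m)%N, (k * Q <= N ^ d)%N,
    m%:R * delta <= (4 * N%:R)^-1 &
    (4 * N%:R) `^ (d%:R + sigma - 1) <= (m * k)%:R :> R].
Proof.
move=> d0 s1 k0 Q0; set E := (8 * Q%:R) `^ _ => hd.
have dR : 1 <= d%:R :> R by rewrite ler1n.
have kR : 1 <= k%:R :> R by rewrite ler1n.
have QR : 1 <= Q%:R :> R by rewrite ler1n.
pose t : R := k%:R `^ d%:R^-1.
have t1 : 1 <= t by rewrite -(powRr0 k%:R) ler_powR// invr_ge0; lra.
have td : t ^+ d = k%:R.
  by rewrite -powR_mulrn ?powR_ge0// -powRrM mulVf ?powRr1//; lra.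
(* As [t] is k^(1/d) and at least 1, t < n <= 2 t. With N = Q n this yields both k Q <= N^d and 4 N
   <= 8 Q t, which is the origin of the constant 8 Q. *)
pose n := (Num.truncn t).+1.
have /andP[nt tn] : (Num.truncn t)%:R <= t < n%:R.
  by apply: truncn_itv; exact: le_trans t1.
have n2 : n%:R <= 2 * t by rewrite /n -natr1; lra.
have kn : (k <= n ^ d)%N.
  by rewrite -(ler_nat R) natrX -td lerXn2r ?nnegrE//; lra.
pose N := (Q * n)%N; pose M : R := 4 * N%:R.
have N1 : 1 <= N%:R :> R by rewrite ler1n muln_gt0 Q0.
have kQN : (k * Q <= N ^ d)%N.
  rewrite /N expnMn mulnC leq_mul// -[leqLHS]expn1 leq_pexp2l//.
pose X := M `^ (d%:R + sigma - 1).
have kX : k%:R <= X.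
  apply: (@le_trans _ _ (M `^ d%:R)); last by rewrite ler_powR /M; lra.
  rewrite powR_mulrn; last by rewrite /M; lra.
  apply: (@le_trans _ _ (N%:R ^+ d)).
    by rewrite -natrX ler_nat (leq_trans _ kQN)// leq_pmulr.
  by rewrite lerXn2r ?nnegrE /M; lra.
(* Since X / k >= 1, rounding it up to [m] at most doubles it; the factor 2 in the bound on [delta]
   compensates for this. *)
pose m := (Num.truncn (X / k%:R)).+1.
have Xk1 : 1 <= X / k%:R by rewrite ler_pdivlMr ?mul1r//; apply: lt_le_trans kR.
have /andP[m1 m2] : (Num.truncn (X / k%:R))%:R <= X / k%:R < m%:R.
  by apply: truncn_itv; exact: le_trans Xk1.
have m3 : m%:R <= 2 * (X / k%:R) by rewrite /m -natr1 mulr2n mulrDl mul1r lerD.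
exists N, m; split => //; first by rewrite leq_pmulr.
  rewrite -/M.
  have E0 : 0 < E by rewrite powR_gt0//; lra.
  have M0 : 0 < M by rewrite /M; lra.
  (* X M = M^(d + sigma) is at most (8 Q t)^(d + sigma), and t^(d + sigma) = k k^(sigma/d). *)
  have XM : X * M <= E * k%:R * k%:R `^ (sigma / d%:R).
    have -> : X * M = M `^ (d%:R + sigma).
      rewrite -[in LHS](powRr1 (ltW M0)) /X -powRD; first by congr (_ `^ _); ring.
      by rewrite (gt_eqF M0) implybT.
    apply: (@le_trans _ _ ((8 * Q%:R * t) `^ (d%:R + sigma))).
      have t0 : 0 <= t by lra.
      apply: ge0_ler_powR; rewrite ?nnegrE ?mulr_ge0//; try lra.
      rewrite /M /N natrM (_ : 8 * Q%:R * t = 4 * (Q%:R * (2 * t))); last by ring.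
      by rewrite ler_pM2l// ler_wpM2l.
    rewrite powRM ?mulr_ge0//; try lra.
    rewrite -/E -mulrA ler_pM2l// /t -powRrM mulrDr mulVf; last by lra.
    rewrite powRD; last by rewrite pnatr_eq0 -lt0n k0 implybT.
    by rewrite powRr1 ?[_^-1 * _]mulrC//; lra.
  set K := k%:R `^ (sigma / d%:R) in XM.
  have K0 : 0 < K by rewrite powR_gt0//; lra.
  have {}hd : delta <= (2 * E * K)^-1 by rewrite invfM (le_trans hd)// powRN.
  rewrite -[leRHS]mul1r ler_pdivlMr//.
  apply: (@le_trans _ _ (2 * (X / k%:R) * (2 * E * K)^-1 * M)).
    rewrite ler_pM2r//; apply: (@le_trans _ _ (m%:R * (2 * E * K)^-1)).
      by rewrite ler_wpM2l.
    by rewrite ler_wpM2r// invr_ge0 !mulr_ge0// ltW.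
  have -> : 2 * (X / k%:R) * (2 * E * K)^-1 * M = X * M / (E * k%:R * K).
    by field; rewrite !gt_eqF//; lra.
  by rewrite ler_pdivrMr ?mul1r// !mulr_gt0//; lra.
rewrite natrM -ler_pdivrMr; last by lra.
exact: ltW.
Qed.

(** * Hits of a fixed ball during a block of consecutive times *)

Section blocks.
Variables (R : realType) (d : nat) (alpha : 'rV[R]_d).
Variables (mu : probability (torus R d) R) (muH : is_Haar mu).
Implicit Types x y : torus R d.

Lemma torus_normN x : torus_norm (- x) = torus_norm x.
Proof. by rewrite -[x]reprK -raddfN !torus_norm_pi normZN. Qed.

Lemma torus_normD x y : torus_norm (x + y) <= torus_norm x + torus_norm y.
Proof. by rewrite -[x]reprK -[y]reprK -raddfD !torus_norm_pi normZD. Qed.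

Lemma torus_normMn x n : torus_norm (x *+ n) <= n%:R * torus_norm x.
Proof.
elim: n => [|n IH].
  by rewrite mulr0n mul0r -[X in torus_norm X](subrr x) -/(torus_dist x x) torus_distxx.
by rewrite mulrS -natr1 mulrDl mul1r (le_trans (torus_normD _ _))// addrC lerD2r.
Qed.

Lemma pi_scale_nat n :
  \pi_(torus R d) (n%:R *: alpha) = \pi_(torus R d) alpha *+ n.
Proof. by rewrite scaler_nat raddfMn. Qed.

Lemma iter_rotation n : iter n (rotation alpha) = rotation (n%:R *: alpha).
Proof.
apply/funext => x; rewrite /rotation pi_scale_nat.
by elim: n => [|n IH]; rewrite ?mulr0n ?addr0//= IH /rotation -addrA -mulrSr.
Qed.

Definition block_hits (b l : nat) (rho : R) : set (torus R d) :=
  \bigcup_(i in `I_l) (iter (b + i) (rotation alpha) @^-1` ball (0 : torus R d) rho).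

Lemma measurable_iter_ball n rho :
  measurable (iter n (rotation alpha) @^-1` ball (0 : torus R d) rho).
Proof.
rewrite iter_rotation -[X in measurable X]setTI.
exact: rotation_measurable (measurable_torus_ball _ _).
Qed.

Lemma measurable_block_hits b l rho : measurable (block_hits b l rho).
Proof. by apply: bigcup_measurable => i _; exact: measurable_iter_ball. Qed.

(** Write i = q k + a with a < k and q < m. Replacing time b + i by b + a moves the orbit point by q
    k alpha, of norm at most [rho], so doubling the radius keeps the hit. *)
Lemma block_hits_sub b k m rho : (0 < k)%N ->
  m%:R * normZ (k%:R *: alpha) <= rho ->
  block_hits b (m * k) rho `<=` block_hits b k (2 * rho).
Proof.
move=> k0 mk x [i /= im]; rewrite torus_ballE => xi.
exists (i %% k)%N; first exact: ltn_pmod.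
rewrite /= torus_ballE; move: xi; rewrite !sub0r !torus_normN {1}(divn_eq i k).
set q := (i %/ k)%N; set a := (i %% k)%N; rewrite !iter_rotation => xi.
have -> : rotation ((b + a)%:R *: alpha) x =
   rotation ((b + (q * k + a))%:R *: alpha) x - \pi_(torus R d) (k%:R *: alpha) *+ q.
  rewrite /rotation !pi_scale_nat -mulrnA -addrA; congr (x + _).
  have -> : (b + (q * k + a) = (b + a) + k * q)%N by lia.
  by rewrite [in RHS]mulrnDr addrK.
apply: le_lt_trans (torus_normD _ _) _; rewrite torus_normN.
have : torus_norm (\pi_(torus R d) (k%:R *: alpha) *+ q) <= rho.
  apply: le_trans (torus_normMn _ _) _; apply: le_trans mk.
  rewrite torus_norm_pi ler_wpM2r ?normZ_ge0// ler_nat.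
  by apply: ltnW; rewrite /q ltn_divLR.
lra.
Qed.

Lemma block_hits_le b k rho (c : R) :
  (mu (ball (0%R : torus R d) rho) <= c%:E)%E ->
  (mu (block_hits b k rho) <= (c *+ k)%:E)%E.
Proof.
move=> hc; rewrite -[k in leRHS](size_iota 0).
apply: (@measure_bigcup_seq_le _ _ _ mu _ (iota 0 k)
  (fun i => iter (b + i) (rotation alpha) @^-1` ball (0 : torus R d) rho)) => [i||x|i].
- exact: measurable_iter_ball.
- exact: measurable_block_hits.
- by move=> [i /= ik xi]; exists i; rewrite //= mem_iota.
- rewrite iter_rotation; apply: le_trans hc.
  by rewrite -[leLHS]/(mu _) (rotation_preserving _ muH)//; exact: measurable_torus_ball.
Qed.

Lemma exists_block (sigma : R) (Q : nat) :
  (0 < d)%N -> 1 <= sigma -> ~ Omega d (sigma - 1) alpha -> (0 < Q)%N ->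
  exists N l : nat, [/\ (Q <= N)%N, (0 < l)%N,
    (1 <= mu (ball (0%R : torus R d) (4 * N%:R)^-1) `^ ((d%:R + sigma - 1) / d%:R)
          *+ l)%E &
    forall b, (mu (block_hits b l (4 * N%:R)^-1) <= (Q%:R^-1)%:E)%E].
Proof.
move=> d0 s1 nO Q0.
(* This is the constant of [block_parameters]. It depends on [Q] but not on [k], so the failure of
   the Diophantine condition for it supplies [k]. *)
pose C : R := (2 * (8 * Q%:R) `^ (d%:R + sigma))^-1.
have C0 : 0 < C by rewrite invr_gt0 mulr_gt0 ?powR_gt0 ?mulr_gt0 ?ltr0n.
have [k [k0 hk]] : exists k : nat, (0 < k)%N /\
    normZ (k%:R *: alpha) <= C * k%:R `^ (- (sigma / d%:R)).
  apply: contrapT => h; apply: nO; exists C => // k k0.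
  rewrite leNgt; apply/negP => hk; apply: h; exists k; split => //.
  by rewrite ltW// (lt_le_trans hk)// addrC subrK mulNr.
have [N [m [QN m0 kQN mN Nm]]] := block_parameters d0 s1 k0 Q0 hk.
have N0 : (0 < N)%N by exact: leq_trans QN.
exists N, (m * k)%N; split => //; first by rewrite muln_gt0 m0.
(* The ball of radius 1/(4N) has measure at least (4N)^(-d), whose power s = (d + sigma - 1)/d is
   (4N)^(-(d + sigma - 1)); by the choice of [m], m k such terms add up to at least 1. *)
- have h4 : (0 < 4 * N)%N by rewrite muln_gt0.
  have := Haar_ball_ge muH h4; rewrite natrM => hb.
  set u := 4 * N%:R in hb Nm *.
  have u0 : 0 < u by rewrite mulr_gt0// ltr0n.
  have fm : mu (ball (0 : torus R d) u^-1) \is a fin_num.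
    by apply: fin_num_measure; exact: measurable_torus_ball.
  move: hb; rewrite -(fineK fm) lee_fin poweR_EFin -EFin_natmul lee_fin => hb.
  apply: (@le_trans _ _ ((u `^ (d%:R + sigma - 1))^-1 *+ (m * k))).
    rewrite -[leRHS]mulr_natl ler_pdivlMr ?mul1r// powR_gt0//.
  rewrite lerMn2r; apply/orP; right.
  have dR : 1 <= d%:R :> R by rewrite ler1n.
  set s := _ / d%:R.
  have -> : d%:R + sigma - 1 = d%:R * s by rewrite /s; field; lra.
  rewrite powRrM powR_mulrn ?(ltW u0)// -powRN -[- s]mulN1r (powRrM _ (-1)).
  rewrite powR_inv1 ?exprn_ge0 ?(ltW u0)//.
  apply: ge0_ler_powR; rewrite ?nnegrE ?invr_ge0 ?exprn_ge0 ?(ltW u0) ?fine_ge0//.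
  by rewrite divr_ge0//; lra.
(* The hits during m k times lie in those of k times with radius 1/(2N), each of measure at most
   N^(-d); then k Q <= N^d gives 1/Q. *)
- move=> b; apply: (@le_trans _ _ (mu (block_hits b k (2 * (4 * N%:R)^-1)))).
    apply: le_measure; rewrite ?inE; [exact: measurable_block_hits..|].
    exact: block_hits_sub.
  have -> : 2 * (4 * N%:R)^-1 = (2 * N%:R)^-1 :> R by field; rewrite pnatr_eq0; lia.
  apply: le_trans (block_hits_le _ _ (Haar_ball_le muH N0)) _.
  rewrite lee_fin -[leLHS]mulr_natl ler_pdivrMr ?exprn_gt0 ?ltr0n//.
  by rewrite mulrC ler_pdivlMr ?ltr0n// -natrM -natrX ler_nat.
Qed.

End blocks.

(** * Concatenation of blocks of prescribed lengths *)

Section block_index.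
Variables (l : nat -> nat) (l_gt0 : forall j, (0 < l j)%N).

Definition block_start (j : nat) : nat := (\sum_(i < j) l i)%N.

(** The number of the block containing [n], when block j occupies the indices from [block_start j]
    up to but excluding [block_start j.+1]. Advancing by at most one block per step suffices because
    blocks are nonempty. *)
Fixpoint block_index (n : nat) : nat :=
  if n is m.+1 then
    let j := block_index m in if (block_start j.+1 <= n)%N then j.+1 else j
  else 0%N.

Lemma block_startS j : block_start j.+1 = (block_start j + l j)%N.
Proof. by rewrite /block_start big_ord_recr. Qed.

Lemma block_indexP n :
  (block_start (block_index n) <= n < block_start (block_index n).+1)%N.
Proof.
elim: n => [|n /andP[h1 h2]] /=.
  by rewrite block_startS /block_start big_ord0 add0n l_gt0.
case: ifP => [h|/negbT]; last by rewrite -ltnNge => ->; rewrite (leq_trans h1).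
by rewrite h block_startS; have := l_gt0 (block_index n).+1; lia.
Qed.

Lemma block_start_mono : {homo block_start : i j / (i <= j)%N}.
Proof.
by apply: homo_leq => [//|i j k|i]; [exact: leq_trans|rewrite block_startS leq_addr].
Qed.

Lemma block_index_unique j n :
  (block_start j <= n < block_start j.+1)%N -> block_index n = j.
Proof.
move=> /andP[h1 h2]; have /andP[h3 h4] := block_indexP n.
apply/eqP; rewrite eqn_leq -ltnS -[X in _ && X]ltnS; apply/andP; split.
  by rewrite ltnNge; apply/negP => /block_start_mono h; lia.
by rewrite ltnNge; apply/negP => /block_start_mono h; lia.
Qed.

(** Each complete block contributes at least 1, so the first K blocks give a partial sum of at least
    K. The shift [n.-1] reconciles times starting at 1 with blocks starting at 0. *)
Lemma block_series_pinfty (R : realType) (u : nat -> \bar R) :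
  (forall j, (0 <= u j)%E) -> (forall j, (1 <= u j *+ l j)%E) ->
  (\sum_(1 <= n <oo) u (block_index n.-1) = +oo)%E.
Proof.
move=> u0 u1.
have partial K : (K%:R%:E <= \sum_(1 <= n < (block_start K).+1) u (block_index n.-1))%E.
  rewrite big_add1 /=; elim: K => [|K IH]; first by rewrite sume_ge0.
  rewrite (@big_cat_nat _ _ _ (block_start K)) ?block_startS ?leq_addr//=.
  rewrite -natr1 EFinD leeD//; apply: (le_trans (u1 K)).
  rewrite -{1}[block_start K]add0n big_addn addKn.
  rewrite (eq_big_nat _ _ (F2 := fun=> u K)); last first.
    move=> i /andP[_ iK]; congr u; apply: block_index_unique.
    by rewrite leq_addl block_startS addnC ltn_add2l.
  by rewrite big_const_nat subn0 iter_addr addr0.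
apply: eq_infty => t.
apply: (@le_trans _ _ (Num.truncn `|t|).+1%:R%:E).
  by rewrite lee_fin (le_trans (ler_norm t))// ltW// truncnS_gt.
by apply: le_trans (partial _) _; apply: nneseries_lim_ge.
Qed.

End block_index.

(** * Limsup sets and failure of the shrinking target property *)

Lemma infinite_set_natP (D : set nat) :
  infinite_set D <-> forall N, exists2 n, D n & (N < n)%N.
Proof.
split=> [Di N|h /finite_seqP[s Ds]].
  apply: contrapT => h; apply: Di.
  apply: (@sub_finite_set _ _ `I_N.+1); last exact: finite_II.
  by move=> n Dn /=; rewrite ltnS leqNgt; apply/negP => Nn; apply: h; exists n.
have [n] := h (\max_(i <- s) i)%N; rewrite Ds /= => ns.
by rewrite ltnNge (leq_bigmax_seq _ ns).
Qed.

Lemma measurable_limsup_hits (R : realType) disp (S : mpSystem R disp)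
    (A : nat -> set S) :
  (forall n, (0 < n)%N -> measurable (iter n (@mps_map R disp S) @^-1` A n)) ->
  measurable (limsup_hits A).
Proof.
move=> mA.
rewrite (_ : limsup_hits A =
  \bigcap_N \bigcup_(n in [set n | (N < n)%N]) (iter n (@mps_map R disp S) @^-1` A n)).
  apply: bigcapT_measurable => N; apply: bigcup_measurable => n Nn.
  by apply: mA; exact: leq_ltn_trans Nn.
apply/seteqP; split => x.
  move=> /infinite_set_natP h N _; have [n [n0 An] Nn] := h N.
  by exists n.
move=> h; apply/infinite_set_natP => N; have [n Nn An] := h N I.
by exists n => //; split => //; exact: leq_ltn_trans Nn.
Qed.

Theorem proposition2p1 (R : realType) (d : nat) (sigma : R) (alpha : 'rV[R]_d)
    (mu : probability (torus R d) R) (muH : is_Haar mu)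
    (d1 : (1 <= d)%N) (sigma1 : 1 <= sigma) :
  ~ Omega d (sigma - 1) alpha ->
  ~ sMSTP (rotation_system alpha muH) ((d%:R + sigma - 1) / d%:R).
Proof.
move=> nO; set s := _ / d%:R.
have /choice[f fP] (Q : nat) : exists Nl : nat * nat, (0 < Q)%N ->
    [/\ (Q <= Nl.1)%N, (0 < Nl.2)%N,
      (1 <= mu (ball (0%R : torus R d) (4 * Nl.1%:R)^-1) `^ s *+ Nl.2)%E &
      forall b, (mu (block_hits alpha b Nl.2 (4 * Nl.1%:R)^-1) <= (Q%:R^-1)%:E)%E].
  have [->|Q0] := posnP Q; first by exists (0%N, 0%N).
  by have [N [l h]] := exists_block muH d1 sigma1 nO Q0; exists (N, l).
(* Taking Q_(j+1) = 2 N_j serves two purposes: N_j >= Q_j makes Q at least double at each step,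
   starting from 4, and N_(j+1) >= Q_(j+1) >= N_j makes the radii nonincreasing. *)
pose Q := fix Q j : nat := if j is i.+1 then (2 * (f (Q i)).1)%N else 4%N.
have Q_ge j : (2 ^ (j + 2) <= Q j)%N.
  elim: j => //= j IH; rewrite addSn expnS leq_mul2l (leq_trans IH)//.
  by have [] := fP (Q j) (leq_trans (expn_gt0 2 _) IH).
have Q0 j : (0 < Q j)%N by apply: leq_trans (Q_ge j); rewrite expn_gt0.
pose N j := (f (Q j)).1; pose l j := (f (Q j)).2; pose rho j : R := (4 * (N j)%:R)^-1.
have QN j : (Q j <= N j)%N by have [] := fP _ (Q0 j).
have l0 j : (0 < l j)%N by have [] := fP _ (Q0 j).
have rho0 j : 0 <= rho j by rewrite invr_ge0 mulr_ge0.
have rhoS j : rho j.+1 <= rho j.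
  rewrite lef_pV2 ?posrE ?mulr_gt0 ?ltr0n ?(leq_trans (Q0 _) (QN _))//.
  rewrite ler_pM2l// ler_nat; apply: leq_trans (QN j.+1).
  by rewrite /= -/(N j) leq_pmull.
pose r n := rho (block_index l n.-1).
move=> /(_ (0 : torus R d) r)[].
- case=> // n _; split; first exact: rho0.
  by rewrite /r /=; case: ifP.
- apply: (block_series_pinfty l0
    (u := fun j => (mu (ball (0%R : torus R d) (rho j)) `^ s)%E)).
    by move=> j; exact: poweR_ge0.
  by move=> j; have [] := fP _ (Q0 j).
move=> _ _; set L := limsup_hits _.
have mL : measurable L.
  by apply: measurable_limsup_hits => n _; exact: measurable_iter_ball.
(* The successor accounts for the shift in [r]: block j governs the times n with [n.-1] in it, so
   its first time is [(block_start l j).+1]. *)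
pose H j := block_hits alpha (block_start l j).+1 (l j) (rho j).
(* Infinitely many hits provide one at some n > 0, and that hit belongs to the block of [n.-1]. *)
have LH : L `<=` \bigcup_j H j.
  move=> x /infinite_set_natP/(_ 0%N)[n [_ xn] n0].
  have /andP[h1 h2] := block_indexP l0 n.-1.
  exists (block_index l n.-1) => //; set j := block_index l n.-1 in xn h1 h2 *.
  exists (n.-1 - block_start l j)%N; first by rewrite /= ltn_subLR// -block_startS.
  by rewrite addSn subnKC// prednK.
have : (mu L <= (2^-1)%:E)%E.
  apply: le_trans (measure_sigma_subadditive mu _ mL LH) _.
    by move=> j; exact: measurable_block_hits.
  (* Block j has hits of measure at most 1/Q_j <= 2^(-(j+2)), and these bounds sum to 1/2, whereas
     Borel-Cantelli would give [L] measure 1. *)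
  have <- : (\sum_(j <oo) (1 / (2 ^ (j + 2))%:R)%:E = (2^-1)%:E :> \bar R)%E.
    by have /cvg_lim -> := @cvg_geometric_eseries_half R 1 1 => //; rewrite div1r expr1.
  apply: lee_nneseries => [//|j _].
  have [_ _ _ /(_ (block_start l j).+1)] := fP _ (Q0 j).
  move=> /le_trans; apply; rewrite lee_fin div1r lef_pV2 ?posrE ?ltr0n ?expn_gt0//.
  by rewrite ler_nat.
move=> h1 h2; move: h1; rewrite [mu L]h2 [X in (X <= _)%E]probability_setT lee_fin; lra.
Qed.
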